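(* Let $S(i_1,j_1;i_2,j_2\,|\,\lambda,v;x,y)$ denote the weights defined in the context. For any fixed $x,y,\lambda,v\in\mathbb{C}$ and $i_1,j_1\in\{0,1\}$, $$\sum_{i_2,j_2\in\{0,1\}} S(i_1,j_1;i_2,j_2\,|\,\lambda,v;x,y)=1 .$$ Furthermore, for any fixed $i_1,j_1,k_1,i_3,j_3,k_3\in\{0,1\}$ and $\lambda,v,x,y,z\in\mathbb{C}$, $$\begin{aligned} \sum_{i_2,j_2,k_2\in\{0,1\}} & S(i_1,j_1;i_2,j_2\,|\,\lambda,\,v-2\eta k_1;x,y)\; S(k_1,j_2;k_2,j_3\,|\,\lambda+2\eta(2i_2-1),\,v;x,z)\; S(k_2,i_2;k_3,i_3\,|\,\lambda,\,v-2\eta j_3;y,z)\\ =\sum_{i_2,j_2,k_2\in\{0,1\}} & S(k_1,i_1;k_2,i_2\,|\,\lambda+2\eta(2j_1-1),\,v;y,z)\; S(k_2,j_1;k_3,j_2\,|\,\lambda,\,v-2\eta i_2;x,z)\; S(i_2,j_2;i_3,j_3\,|\,\lambda+2\eta(2k_3-1),\,v;x,y). \end{aligned}$$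
   Context: Fix $\tau,\eta\in\mathbb{C}$ with $\Im\tau>0$. Let $f$ be the first Jacobi theta function $$f(z)=-\sum_{j=-\infty}^{\infty}\exp\Big(\pi \mathrm{i}\tau\big(j+\tfrac12\big)^2+2\pi \mathrm{i}\big(j+\tfrac12\big)\big(z+\tfrac12\big)\Big).$$ For $\lambda,v,x,y\in\mathbb{C}$ define $$\begin{aligned} S(1,0;1,0\,|\,\lambda,v;x,y)&=\frac{f(y-x)f(\lambda-2\eta)}{f(y-x+2\eta)f(\lambda)}\,\frac{f(\lambda+y-v+2\eta)f(x-v)}{f(x-v+2\eta)f(\lambda+y-v)},\\ S(0,1;1,0\,|\,\lambda,v;x,y)&=\frac{f(\lambda-y+x)f(2\eta)}{f(y-x+2\eta)f(\lambda)}\,\frac{f(\lambda+y-v+2\eta)f(x-v)}{f(\lambda+x-v+2\eta)f(y-v)},\\ S(1,0;0,1\,|\,\lambda,v;x,y)&=\frac{f(\lambda+y-x)f(2\eta)}{f(y-x+2\eta)f(\lambda)}\,\frac{f(y-v+2\eta)f(\lambda+x-v)}{f(x-v+2\eta)f(\lambda+y-v)},\\ S(0,1;0,1\,|\,\lambda,v;x,y)&=\frac{f(y-x)f(\lambda+2\eta)}{f(y-x+2\eta)f(\lambda)}\,\frac{f(\lambda+x-v)f(y-v+2\eta)}{f(\lambda+x-v+2\eta)f(y-v)},\\ S(0,0;0,0\,|\,\lambda,v;x,y)&=1=S(1,1;1,1\,|\,\lambda,v;x,y), \end{aligned}$$ and $S(i_1,j_1;i_2,j_2\,|\,\lambda,v;x,y)=0$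 for all other $(i_1,j_1;i_2,j_2)$. Parameters are assumed to be such that all denominators appearing are nonzero. *)

(* Defs.v *)
From Stdlib Require Import Reals ZArith.
From Coquelicot Require Import Coquelicot.

Open Scope R_scope.
Open Scope C_scope.

Definition Cexp (z : C) : C :=
  (exp (Re z) * cos (Im z), exp (Re z) * sin (Im z))%R.

(* [Series] is total on real sequences; a complex series converges exactly when
   its real and imaginary parts do, and its sum is then computed this way. *)
Definition CSeries (a : nat -> C) : C :=
  (Series (fun n => Re (a n)), Series (fun n => Im (a n))).

(* Sum over all j in Z, split as j >= 0 and j <= -1. *)
Definition CSeriesZ (a : Z -> C) : C :=
  CSeries (fun n => a (Z.of_nat n)) + CSeries (fun n => a (- Z.of_nat n - 1)%Z).

Definition theta_term (tau z : C) (j : Z) : C :=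
  let h : C := RtoC (IZR j) + 1 / 2 in
  Cexp (PI * Ci * tau * (h * h) + 2 * PI * Ci * h * (z + 1 / 2)).

Definition theta1 (tau z : C) : C := - CSeriesZ (theta_term tau z).

(* The indices in {0,1} are booleans, with false = 0 and true = 1. *)
Definition bit (b : bool) : C := if b then 1 else 0.

Definition sum01 (F : bool -> C) : C := F false + F true.

Definition weight (tau eta : C) (i1 j1 i2 j2 : bool) (lam v x y : C) : C :=
  let f := theta1 tau in
  match i1, j1, i2, j2 with
  | true, false, true, false =>
      (f (y - x) * f (lam - 2 * eta)) / (f (y - x + 2 * eta) * f lam)
      * ((f (lam + y - v + 2 * eta) * f (x - v))
         / (f (x - v + 2 * eta) * f (lam + y - v)))
  | false, true, true, false =>
      (f (lam - y + x) * f (2 * eta)) / (f (y - x + 2 * eta) * f lam)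
      * ((f (lam + y - v + 2 * eta) * f (x - v))
         / (f (lam + x - v + 2 * eta) * f (y - v)))
  | true, false, false, true =>
      (f (lam + y - x) * f (2 * eta)) / (f (y - x + 2 * eta) * f lam)
      * ((f (y - v + 2 * eta) * f (lam + x - v))
         / (f (x - v + 2 * eta) * f (lam + y - v)))
  | false, true, false, true =>
      (f (y - x) * f (lam + 2 * eta)) / (f (y - x + 2 * eta) * f lam)
      * ((f (lam + x - v) * f (y - v + 2 * eta))
         / (f (lam + x - v + 2 * eta) * f (y - v)))
  | false, false, false, false => 1
  | true, true, true, true => 1
  | _, _, _, _ => 0
  end.

(* The denominator occurring in [weight] at the same arguments (1 if none).
   It depends on the outgoing pair (i2, j2) only through i2 + j2. *)
Definition weight_den (tau eta : C) (i1 j1 i2 j2 : bool) (lam v x y : C) : C :=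
  let f := theta1 tau in
  match i1, j1, i2, j2 with
  | true, false, true, false | true, false, false, true =>
      f (y - x + 2 * eta) * f lam * (f (x - v + 2 * eta) * f (lam + y - v))
  | false, true, true, false | false, true, false, true =>
      f (y - x + 2 * eta) * f lam * (f (lam + x - v + 2 * eta) * f (y - v))
  | _, _, _, _ => 1
  end.

Definition weight_ok (tau eta : C) (i1 j1 i2 j2 : bool) (lam v x y : C) : Prop :=
  weight_den tau eta i1 j1 i2 j2 lam v x y <> 0.

(* Main.v *)
(** Substituting [m = j + k + 1], [n = j - k] in the double series for
    [f (x + y) * f (x - y)] splits it, according to the parity of [m], as
    [E x * O y - O x * E y], with [E] and [O] theta functions of modulus [2 tau].
    The Weierstrass three-term identity for [f] is then the Pluecker relation
    between 2x2 minors.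

    The sum rule is one instance of the three-term identity. In each component
    of the second equation the factors depending on [v] are common to all terms.
    What remains is trivial, or a single instance of the three-term identity, or,
    in the two components with four terms, a combination of two instances. *)

Require Import Defs.
From Stdlib Require Import Reals ZArith List Permutation Classical Lra Lia.
From Coquelicot Require Import Coquelicot.
Import ListNotations.

Open Scope R_scope.
Open Scope C_scope.

(** * Unconditional sums *)

Definition lsum {I : Type} (a : I -> C) (F : list I) : C :=
  fold_right (fun i s => a i + s) 0 F.

(** Convergence along finite subsets, given as duplicate-free lists. No enumeration of [I] is fixed,
    so double series can be reindexed by any bijection. *)
Definition has_sum {I : Type} (a : I -> C) (s : C) : Prop :=
  forall eps : R, (0 < eps)%R ->
  exists F0, forall F, NoDup F -> incl F0 F -> (Cmod (lsum a F - s) < eps)%R.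

(** Complex-valued, so that [lsum] and [has_sum] apply to absolute values as well. *)
Definition norms {I : Type} (a : I -> C) (i : I) : C := RtoC (Cmod (a i)).

Definition abs_sum {I : Type} (a : I -> C) (s : C) : Prop :=
  has_sum a s /\ exists A, has_sum (norms a) A.

Lemma exists_nodup {I : Type} (F : list I) :
  exists F', NoDup F' /\ incl F F' /\ incl F' F.
Proof.
  induction F as [|x F (F' & ND & H1 & H2)].
  - exists []. split; [constructor|split; intros y; auto].
  - destruct (classic (In x F')) as [Hx|Hx].
    + exists F'. split; [auto|split].
      * intros y [<-|Hy]; auto.
      * intros y Hy; right; auto.
    + exists (x :: F'). split; [now constructor|split].
      * intros y [<-|Hy]; [now left|right; auto].
      * intros y [<-|Hy]; [now left|right; auto].
Qed.

(** Provides a complement of [K] in [H], so that a sum over [H] splits off the sum over [K]. *)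
Lemma incl_permutation {I : Type} (K H : list I) :
  NoDup K -> NoDup H -> incl K H -> exists R, Permutation H (K ++ R).
Proof.
  revert H; induction K as [|x K IH]; intros H NK NH HKH.
  - now exists H.
  - inversion NK as [|? ? Hx NK']; subst.
    destruct (in_split x H) as (H1 & H2 & ->); [apply HKH; now left|].
    destruct (IH (H1 ++ H2)) as (R & HR); [auto| |  |].
    + eapply NoDup_remove_1; eauto.
    + intros y Hy. assert (Hy' : In y (H1 ++ x :: H2)) by (apply HKH; now right).
      apply in_app_iff in Hy'. apply in_app_iff.
      destruct Hy' as [?|[->|?]]; auto; contradiction.
    + exists R. simpl. rewrite <- Permutation_middle. now constructor.
Qed.

Lemma lsum_app {I : Type} (a : I -> C) F G : lsum a (F ++ G) = lsum a F + lsum a G.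
Proof.
  induction F as [|x F IH]; simpl; [ring|]. rewrite IH; ring.
Qed.

Lemma lsum_permutation {I : Type} (a : I -> C) F G :
  Permutation F G -> lsum a F = lsum a G.
Proof.
  induction 1; simpl; try congruence; ring.
Qed.

Lemma lsum_ext {I : Type} (a b : I -> C) F :
  (forall i, a i = b i) -> lsum a F = lsum b F.
Proof.
  intros E; induction F; simpl; congruence.
Qed.

Lemma lsum_map {I J : Type} (g : J -> I) (a : I -> C) F :
  lsum a (map g F) = lsum (fun j => a (g j)) F.
Proof. induction F; simpl; congruence. Qed.

Lemma lsum_scal {I : Type} (c : C) (a : I -> C) F :
  lsum (fun i => c * a i) F = c * lsum a F.
Proof. induction F as [|x F IH]; simpl; [ring|rewrite IH; ring]. Qed.

Lemma lsum_prod {I J : Type} (a : I -> C) (b : J -> C) F G :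
  lsum (fun p => a (fst p) * b (snd p)) (list_prod F G) = lsum a F * lsum b G.
Proof.
  induction F as [|x F IH]; simpl; [ring|].
  rewrite lsum_app, IH, lsum_map. simpl. rewrite lsum_scal. ring.
Qed.

Lemma Re_lsum_norms_ge_0 {I : Type} (a : I -> C) F : (0 <= Re (lsum (norms a) F))%R.
Proof.
  induction F as [|x F IH]; simpl; [lra|].
  pose proof (Cmod_ge_0 (a x)). unfold Re in *. simpl in *. lra.
Qed.

Lemma Cmod_lsum_le {I : Type} (a : I -> C) F :
  (Cmod (lsum a F) <= Re (lsum (norms a) F))%R.
Proof.
  induction F as [|x F IH]; simpl; [rewrite Cmod_0; lra|].
  eapply Rle_trans; [apply Cmod_triangle|]. unfold Re in *. simpl in *. lra.
Qed.

Lemma lsum_norms_incl {I : Type} (a : I -> C) F G :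
  NoDup F -> NoDup G -> incl F G ->
  (Re (lsum (norms a) F) <= Re (lsum (norms a) G))%R.
Proof.
  intros NF NG HFG. destruct (incl_permutation F G NF NG HFG) as (R & HR).
  rewrite (lsum_permutation _ _ _ HR), lsum_app.
  pose proof (Re_lsum_norms_ge_0 a R). unfold Re in *. simpl in *. lra.
Qed.

Lemma Cmod_lsum_minus_le {I : Type} (a : I -> C) F G :
  NoDup F -> NoDup G -> incl F G ->
  (Cmod (lsum a G - lsum a F)
   <= Re (lsum (norms a) G) - Re (lsum (norms a) F))%R.
Proof.
  intros NF NG HFG. destruct (incl_permutation F G NF NG HFG) as (R & HR).
  rewrite !(lsum_permutation _ _ _ HR), !lsum_app.
  replace (lsum a F + lsum a R - lsum a F) with (lsum a R) by ring.
  pose proof (Cmod_lsum_le a R). unfold Re in *. simpl in *. lra.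
Qed.

Lemma Cmod_minus_sym (a b : C) : Cmod (a - b) = Cmod (b - a).
Proof. rewrite <- Cmod_opp. f_equal. ring. Qed.

Lemma Cmod_minus_triangle (a b c : C) : (Cmod (a - c) <= Cmod (a - b) + Cmod (b - c))%R.
Proof.
  replace (a - c) with ((a - b) + (b - c)) by ring. apply Cmod_triangle.
Qed.

(** * Uniqueness, reindexing and disjoint unions *)

Lemma has_sum_unique {I : Type} (a : I -> C) s t : has_sum a s -> has_sum a t -> s = t.
Proof.
  intros Hs Ht.
  destruct (Req_dec (Cmod (s - t)) 0) as [E|E].
  { apply Cmod_eq_0 in E. replace s with ((s - t) + t) by ring. rewrite E. ring. }
  exfalso. pose proof (Cmod_ge_0 (s - t)).
  destruct (Hs (Cmod (s - t) / 2)%R) as (F & HF); [lra|].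
  destruct (Ht (Cmod (s - t) / 2)%R) as (G & HG); [lra|].
  destruct (exists_nodup (F ++ G)) as (K & NK & HK & _).
  apply incl_app_inv in HK. destruct HK as [HK1 HK2].
  specialize (HF K NK HK1). specialize (HG K NK HK2).
  pose proof (Cmod_minus_triangle s (lsum a K) t) as T.
  rewrite (Cmod_minus_sym s (lsum a K)) in T. lra.
Qed.

Lemma has_sum_ext {I : Type} (a b : I -> C) s :
  (forall i, a i = b i) -> has_sum a s -> has_sum b s.
Proof.
  intros E H eps He. destruct (H eps He) as (F0 & HF). exists F0. intros F NF HI.
  rewrite <- (lsum_ext _ _ F E). auto.
Qed.

Lemma has_sum_opp {I : Type} (a : I -> C) s : has_sum a s -> has_sum (fun i => - a i) (- s).
Proof.
  intros H eps He. destruct (H eps He) as (F0 & HF). exists F0. intros F NF HI.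
  rewrite (lsum_ext _ (fun i => - (1) * a i)) by (intros; ring). rewrite lsum_scal.
  replace (- (1) * lsum a F - - s) with (- (lsum a F - s)) by ring.
  rewrite Cmod_opp. auto.
Qed.

(** Only finitely many preimages are chosen, so no inverse of [g] has to be constructed. *)
Lemma lift_list {I J : Type} (g : J -> I) (F : list I) :
  (forall i, exists j, g j = i) -> exists G, map g G = F.
Proof.
  intros S. induction F as [|x F (G & <-)]; [now exists []|].
  destruct (S x) as (j & <-). now exists (j :: G).
Qed.

Lemma has_sum_bij {I J : Type} (g : J -> I) (a : I -> C) s :
  (forall j j', g j = g j' -> j = j') -> (forall i, exists j, g j = i) ->
  has_sum a s -> has_sum (fun j => a (g j)) s.
Proof.
  intros Inj Sur H eps He. destruct (H eps He) as (F0 & HF).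
  destruct (lift_list g F0 Sur) as (G0 & <-). exists G0. intros G NG HI.
  rewrite <- lsum_map. apply HF.
  - apply FinFun.Injective_map_NoDup; auto.
  - now apply incl_map.
Qed.

Lemma list_sum_split {I J : Type} (H : list (I + J)) :
  exists F G, Permutation H (map inl F ++ map inr G).
Proof.
  induction H as [|[i|j] H (F & G & P)].
  - now exists [], [].
  - exists (i :: F), G. simpl. now constructor.
  - exists F, (j :: G). simpl. rewrite <- Permutation_middle. now constructor.
Qed.

Lemma has_sum_sum {I J : Type} (a : I -> C) (b : J -> C) s t :
  has_sum a s -> has_sum b t ->
  has_sum (fun k : I + J => match k with inl i => a i | inr j => b j end) (s + t).
Proof.
  intros Ha Hb eps He.
  destruct (Ha (eps / 2)%R) as (F0 & HF); [lra|].
  destruct (Hb (eps / 2)%R) as (G0 & HG); [lra|].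
  exists (map inl F0 ++ map inr G0). intros H NH HI.
  destruct (list_sum_split H) as (F & G & P).
  rewrite (lsum_permutation _ _ _ P), lsum_app, !lsum_map.
  pose proof (Permutation_NoDup P NH) as ND.
  assert (HI' : incl (map inl F0 ++ map inr G0) (map inl F ++ map inr G)).
  { intros k Hk. eapply Permutation_in; [exact P|auto]. }
  replace (lsum (fun j => a j) F + lsum (fun j => b j) G - (s + t))
    with ((lsum a F - s) + (lsum b G - t))
    by (change (fun j => a j) with a; change (fun j => b j) with b; ring).
  eapply Rle_lt_trans; [apply Cmod_triangle|].
  assert (Cmod (lsum a F - s) < eps / 2)%R.
  { apply HF.
    - apply (NoDup_map_inv (@inl I J)). eapply NoDup_app_remove_r; eauto.
    - intros i Hi. assert (Q : In (inl i) (map (@inl I J) F ++ map inr G))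
        by (apply HI', in_app_iff; left; now apply in_map).
      apply in_app_iff in Q. destruct Q as [Q|Q]; apply in_map_iff in Q;
        destruct Q as (? & E & ?); congruence. }
  assert (Cmod (lsum b G - t) < eps / 2)%R.
  { apply HG.
    - apply (NoDup_map_inv (@inr I J)). eapply NoDup_app_remove_l; eauto.
    - intros i Hi. assert (Q : In (inr i) (map (@inl I J) F ++ map inr G))
        by (apply HI', in_app_iff; right; now apply in_map).
      apply in_app_iff in Q. destruct Q as [Q|Q]; apply in_map_iff in Q;
        destruct Q as (? & E & ?); congruence. }
  lra.
Qed.

(** * Products of absolutely summable families *)

Lemma lsum_norms_le {I : Type} (a : I -> C) A F :
  has_sum (norms a) A -> NoDup F -> (Re (lsum (norms a) F) <= Re A)%R.
Proof.
  intros H NF. apply Rle_plus_epsilon. intros eps He.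
  destruct (H eps He) as (F0 & HF).
  destruct (exists_nodup (F ++ F0)) as (K & NK & HK & _).
  apply incl_app_inv in HK. destruct HK as [HK1 HK2].
  specialize (HF K NK HK2).
  pose proof (lsum_norms_incl a F K NF NK HK1).
  pose proof (re_le_Cmod (lsum (norms a) K - A)) as T.
  unfold Re in *. simpl in T. apply Rabs_le_between in T. lra.
Qed.

Lemma has_sum_nodup {I : Type} (a : I -> C) s eps :
  has_sum a s -> (0 < eps)%R ->
  exists F0, NoDup F0 /\ forall F, NoDup F -> incl F0 F -> (Cmod (lsum a F - s) < eps)%R.
Proof.
  intros H He. destruct (H eps He) as (F0 & HF).
  destruct (exists_nodup F0) as (K & NK & HK & _).
  exists K. split; [auto|]. intros F NF HI. apply HF; auto.
  eapply incl_tran; eauto.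
Qed.

Lemma norms_prod {I J : Type} (a : I -> C) (b : J -> C) H :
  lsum (norms (fun p => a (fst p) * b (snd p))) H
  = lsum (fun p => norms a (fst p) * norms b (snd p)) H.
Proof.
  apply lsum_ext. intros [i j]. unfold norms. simpl. rewrite Cmod_mult. apply RtoC_mult.
Qed.

Lemma Im_lsum_norms {I : Type} (a : I -> C) F : Im (lsum (norms a) F) = 0%R.
Proof. induction F as [|x F IH]; simpl; unfold Im in *; simpl in *; lra. Qed.

Lemma NoDup_list_prod {I J : Type} (F : list I) (G : list J) :
  NoDup F -> NoDup G -> NoDup (list_prod F G).
Proof.
  intros NF NG. induction NF as [|x F Hx NF IH]; simpl; [constructor|].
  apply NoDup_app; auto.
  - apply FinFun.Injective_map_NoDup; [congruence|auto].
  - intros [i j] Hij Hij'. apply in_map_iff in Hij. apply in_prod_iff in Hij'.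
    destruct Hij as (? & E & _). injection E; intros; subst. tauto.
Qed.

(** A large finite set [K] of pairs lies between a fixed rectangle [F0 x G0] and the rectangle
    [F x G] of its projections. What [K] adds to the small rectangle is at most [Re A * Re B] minus
    the sum of absolute values over [F0 x G0]. *)
Lemma has_sum_prod {I J : Type} (a : I -> C) (b : J -> C) s t :
  abs_sum a s -> abs_sum b t ->
  has_sum (fun p : I * J => a (fst p) * b (snd p)) (s * t).
Proof.
  intros [Ha (A & HA)] [Hb (B & HB)] eps He.
  assert (A0 : (0 <= Re A)%R) by (apply (lsum_norms_le a A [] HA); constructor).
  assert (B0 : (0 <= Re B)%R) by (apply (lsum_norms_le b B [] HB); constructor).
  (* The final error is at most [d (Re A + Re B)] from outside the small rectangle plus
     [d (Cmod t + d) + Cmod s * d] on it; as [d <= 1], this is at most [d M]. *)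
  set (M := (Re A + Re B + Cmod s + Cmod t + 1)%R).
  pose proof (Cmod_ge_0 s). pose proof (Cmod_ge_0 t).
  assert (HM : (1 <= M)%R) by (unfold M; lra).
  set (d := Rmin 1 (eps / (4 * M))).
  assert (Hd0 : (0 < d)%R).
  { apply Rmin_pos; [lra|]. apply Rdiv_lt_0_compat; lra. }
  assert (Hd1 : (d <= 1)%R) by apply Rmin_l.
  assert (Hd2 : (d * M <= eps / 4)%R).
  { replace (eps / 4)%R with (eps / (4 * M) * M)%R by (field; lra).
    apply Rmult_le_compat_r; [lra|apply Rmin_r]. }
  destruct (has_sum_nodup a s d Ha Hd0) as (F1 & N1 & H1).
  destruct (has_sum_nodup (norms a) A d HA Hd0) as (F2 & N2 & H2).
  destruct (has_sum_nodup b t d Hb Hd0) as (G1 & N3 & H3).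
  destruct (has_sum_nodup (norms b) B d HB Hd0) as (G2 & N4 & H4).
  destruct (exists_nodup (F1 ++ F2)) as (F0 & NF0 & HF0 & _).
  destruct (exists_nodup (G1 ++ G2)) as (G0 & NG0 & HG0 & _).
  apply incl_app_inv in HF0. destruct HF0 as [I1 I2].
  apply incl_app_inv in HG0. destruct HG0 as [I3 I4].
  specialize (H1 F0 NF0 I1). specialize (H2 F0 NF0 I2).
  specialize (H3 G0 NG0 I3). specialize (H4 G0 NG0 I4).
  exists (list_prod F0 G0). intros K NK HK.
  destruct (exists_nodup (map fst K)) as (F & NF & HF & _).
  destruct (exists_nodup (map snd K)) as (G & NG & HG & _).
  assert (NP0 : NoDup (list_prod F0 G0)) by now apply NoDup_list_prod.
  assert (NP : NoDup (list_prod F G)) by now apply NoDup_list_prod.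
  assert (HKP : incl K (list_prod F G)).
  { intros [i j] Hij. apply in_prod_iff. split.
    - apply HF. now apply (in_map fst) in Hij.
    - apply HG. now apply (in_map snd) in Hij. }
  set (c := fun p : I * J => a (fst p) * b (snd p)) in *.
  pose proof (Cmod_lsum_minus_le c _ _ NP0 NK HK) as Q1.
  pose proof (lsum_norms_incl c _ _ NK NP HKP) as Q2.
  unfold c in Q1, Q2. rewrite !norms_prod in Q2. rewrite !norms_prod in Q1.
  rewrite !lsum_prod in Q2. rewrite !lsum_prod in Q1.
  fold c in Q1, Q2.
  pose proof (Cmod_minus_triangle (lsum c K) (lsum a F0 * lsum b G0) (s * t)) as T.
  assert (T2 : (Cmod (lsum a F0 * lsum b G0 - s * t)
     <= d * (Cmod t + d) + Cmod s * d)%R).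
  { replace (lsum a F0 * lsum b G0 - s * t)
      with ((lsum a F0 - s) * lsum b G0 + s * (lsum b G0 - t)) by ring.
    eapply Rle_trans; [apply Cmod_triangle|]. rewrite !Cmod_mult.
    apply Rplus_le_compat.
    - apply Rmult_le_compat; try apply Cmod_ge_0; [lra|].
      replace (lsum b G0) with ((lsum b G0 - t) + t) by ring.
      eapply Rle_trans; [apply Cmod_triangle|]. lra.
    - apply Rmult_le_compat_l; lra. }
  pose proof (lsum_norms_le a A F HA NF) as U1.
  pose proof (lsum_norms_le b B G HB NG) as U2.
  pose proof (Re_lsum_norms_ge_0 a F) as U3.
  pose proof (Re_lsum_norms_ge_0 b G) as U4.
  assert (V1 : (Re A - d <= Re (lsum (norms a) F0))%R).
  { pose proof (re_le_Cmod (lsum (norms a) F0 - A)) as W.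
    unfold Re in *. simpl in W. apply Rabs_le_between in W. lra. }
  assert (V2 : (Re B - d <= Re (lsum (norms b) G0))%R).
  { pose proof (re_le_Cmod (lsum (norms b) G0 - B)) as W.
    unfold Re in *. simpl in W. apply Rabs_le_between in W. lra. }
  pose proof (lsum_norms_le a A F0 HA NF0) as U5.
  pose proof (lsum_norms_le b B G0 HB NG0) as U6.
  pose proof (Re_lsum_norms_ge_0 a F0) as U7.
  pose proof (Re_lsum_norms_ge_0 b G0) as U8.
  assert (R1 : forall z w : C, Im z = 0%R -> Re (z * w) = (Re z * Re w)%R).
  { intros [z1 z2] [w1 w2]. unfold Re, Im. simpl. intros ->. ring. }
  rewrite (R1 (lsum (norms a) F0)) in Q1 by apply Im_lsum_norms.
  rewrite !R1 in Q2 by apply Im_lsum_norms.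
  assert (X1 : (Re (lsum (norms a) F) * Re (lsum (norms b) G) <= Re A * Re B)%R)
    by (apply Rmult_le_compat; lra).
  set (p := Re (lsum (norms a) F0)) in *. set (q := Re (lsum (norms b) G0)) in *.
  assert (X2 : (Re A * Re B - p * q <= d * (Re A + Re B))%R) by nra.
  unfold M in Hd2. nra.
Qed.

(** * Geometrically bounded and Gaussian series *)

Lemma Cmod_le_Re_Im (z : C) : (Cmod z <= Rabs (Re z) + Rabs (Im z))%R.
Proof.
  replace z with (RtoC (Re z) + Ci * RtoC (Im z)) at 1
    by (destruct z; unfold Re, Im; apply injective_projections; simpl; ring).
  eapply Rle_trans; [apply Cmod_triangle|].
  rewrite Cmod_mult, !Cmod_R.
  assert (E : Cmod Ci = 1%R).
  { transitivity (sqrt 1); [|apply sqrt_1]. unfold Cmod, Ci. simpl. f_equal. ring. }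
  rewrite E. lra.
Qed.

Lemma lsum_seq (a : nat -> C) n :
  lsum a (seq 0 (S n)) = (sum_n (fun k => Re (a k)) n, sum_n (fun k => Im (a k)) n).
Proof.
  induction n as [|n IH].
  - rewrite !sum_O. apply injective_projections; unfold Re, Im; simpl; ring.
  - rewrite seq_S, lsum_app, IH, !sum_Sn.
    apply injective_projections; unfold Re, Im, plus; simpl; ring.
Qed.

Section Geometric.

Variables (a : nat -> C) (M q : R).
Hypothesis q_bounds : (0 <= q < 1)%R.
Hypothesis a_le : forall n, (Cmod (a n) <= M * q ^ n)%R.

Lemma geometric_M_pos : (0 <= M)%R.
Proof. pose proof (a_le 0). pose proof (Cmod_ge_0 (a 0)). simpl in *. lra. Qed.

Lemma norms_tail_le N K :
  (Re (lsum (norms a) (seq N K)) <= M * q ^ N / (1 - q))%R.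
Proof.
  pose proof geometric_M_pos.
  revert N; induction K as [|K IH]; intros N.
  - simpl. apply Rdiv_le_0_compat; [|lra].
    apply Rmult_le_pos; [lra|apply pow_le; lra].
  - specialize (IH (S N)). pose proof (a_le N).
    replace (M * q ^ N / (1 - q))%R with (M * q ^ N + M * q ^ S N / (1 - q))%R
      by (simpl; field; lra).
    simpl in *. unfold Re in *. simpl. lra.
Qed.

Lemma ex_series_dominated (u : nat -> R) :
  (forall n, (Rabs (u n) <= Cmod (a n))%R) -> ex_series u.
Proof.
  intros Hu. apply (ex_series_le u (fun n => M * q ^ n)%R).
  - intros n. eapply Rle_trans; [apply Hu|apply a_le].
  - apply (ex_series_scal_l M (fun n => q ^ n)%R). apply ex_series_geom.
    rewrite Rabs_pos_eq; lra.
Qed.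

(** Links ordered series to unordered sums. A list containing [0..N] differs from that partial sum
    by at most a geometric tail, and the partial sum approaches [CSeries] in real and imaginary
    part: three errors of [eps / 3]. *)
Lemma has_sum_geometric : has_sum a (CSeries a).
Proof.
  pose proof geometric_M_pos.
  intros eps He.
  assert (HR : is_lim_seq (sum_n (fun k => Re (a k))) (Series (fun k => Re (a k)))).
  { apply Series_correct, ex_series_dominated. intros. apply re_le_Cmod. }
  assert (HI : is_lim_seq (sum_n (fun k => Im (a k))) (Series (fun k => Im (a k)))).
  { apply Series_correct, ex_series_dominated. intros n.
    eapply Rle_trans; [apply Rmax_r|apply Rmax_Cmod]. }
  assert (HT : is_lim_seq (fun n => M * q ^ n / (1 - q))%R 0).
  { apply is_lim_seq_ext with (fun n => M / (1 - q) * q ^ n)%R.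
    - intros n. field. lra.
    - replace (Finite 0) with (Rbar_mult (Finite (M / (1 - q))) (Finite 0))
        by (simpl; f_equal; ring).
      apply is_lim_seq_scal_l, is_lim_seq_geom. rewrite Rabs_pos_eq; lra. }
  apply is_lim_seq_spec in HR, HI, HT.
  assert (E3 : (0 < eps / 3)%R) by lra.
  destruct (HR (mkposreal _ E3)) as (N1 & H1).
  destruct (HI (mkposreal _ E3)) as (N2 & H2).
  destruct (HT (mkposreal _ E3)) as (N3 & H3).
  set (N := (N1 + N2 + N3)%nat).
  specialize (H1 N ltac:(lia)). specialize (H2 N ltac:(lia)).
  specialize (H3 (S N) ltac:(lia)). simpl pos in *.
  exists (seq 0 (S N)). intros F NF HF.
  (* [F] lies in the initial segment of length [S N + K], so its excess over [0..N] is bounded by a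
     finite tail. *)
  set (K := S (list_max F)).
  assert (HK : incl F (seq 0 (S N + K))).
  { intros n Hn. apply in_seq. pose proof (list_max_le F (list_max F)) as [L _].
    specialize (L (le_n _)). rewrite Forall_forall in L. specialize (L n Hn).
    unfold K. lia. }
  pose proof (Cmod_lsum_minus_le a _ _ (seq_NoDup _ _) NF HF) as Q1.
  pose proof (lsum_norms_incl a _ _ NF (seq_NoDup _ _) HK) as Q2.
  rewrite seq_app, lsum_app in Q2.
  pose proof (norms_tail_le (0 + S N) K) as Q3.
  pose proof (Cmod_minus_triangle (lsum a F) (lsum a (seq 0 (S N))) (CSeries a)) as T.
  pose proof (Cmod_le_Re_Im (lsum a (seq 0 (S N)) - CSeries a)) as U.
  rewrite lsum_seq in U at 2 3. unfold CSeries in U at 2 3.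
  unfold Re, Im in *. simpl fst in *. simpl snd in *.
  rewrite Rminus_0_r in H3. apply Rabs_lt_between in H3.
  change (0 + S N)%nat with (S N) in *. unfold Rminus in *. lra.
Qed.

End Geometric.

Lemma norms_idem {I : Type} (a : I -> C) i : Cmod (norms a i) = Cmod (a i).
Proof. unfold norms. rewrite Cmod_R, Rabs_pos_eq; auto using Cmod_ge_0. Qed.

Lemma abs_sum_geometric (a : nat -> C) (M q : R) :
  (0 <= q < 1)%R -> (forall n, (Cmod (a n) <= M * q ^ n)%R) -> abs_sum a (CSeries a).
Proof.
  intros Hq Ha. split; [|exists (CSeries (norms a))]; apply has_sum_geometric with M q; auto.
  intros n. now rewrite norms_idem.
Qed.

Lemma has_sum_Z (a : Z -> C) s t :
  has_sum (fun n => a (Z.of_nat n)) s -> has_sum (fun n => a (- Z.of_nat n - 1)%Z) t ->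
  has_sum a (s + t).
Proof.
  intros Hs Ht.
  (* The same cut of the integers as in [CSeriesZ]. *)
  set (g := fun j => if Z_le_dec 0 j then inl (Z.to_nat j) else inr (Z.to_nat (- j - 1))).
  eapply has_sum_ext; [|apply (has_sum_bij g _ _) with (3 := has_sum_sum _ _ _ _ Hs Ht)].
  - intros j. unfold g. destruct (Z_le_dec 0 j); simpl; f_equal; lia.
  - intros j j'. unfold g.
    destruct (Z_le_dec 0 j), (Z_le_dec 0 j'); intros E; try discriminate;
      injection E; lia.
  - intros [n|n].
    + exists (Z.of_nat n). unfold g. destruct Z_le_dec; [f_equal; lia|lia].
    + exists (- Z.of_nat n - 1)%Z. unfold g. destruct Z_le_dec; [lia|f_equal; lia].
Qed.

Lemma abs_sum_Z (a : Z -> C) (M q : R) :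
  (0 <= q < 1)%R -> (forall j, (Cmod (a j) <= M * q ^ Z.abs_nat j)%R) ->
  abs_sum a (CSeriesZ a).
Proof.
  intros Hq Ha.
  assert (M0 : (0 <= M)%R).
  { pose proof (Ha 0%Z). pose proof (Cmod_ge_0 (a 0%Z)). simpl in *. lra. }
  assert (H1 : abs_sum (fun n => a (Z.of_nat n)) (CSeries (fun n => a (Z.of_nat n)))).
  { apply abs_sum_geometric with M q; auto. intros n.
    rewrite <- (Zabs2Nat.id n) at 2. apply Ha. }
  assert (H2 : abs_sum (fun n => a (- Z.of_nat n - 1)%Z)
                 (CSeries (fun n => a (- Z.of_nat n - 1)%Z))).
  { apply abs_sum_geometric with M q; auto. intros n.
    eapply Rle_trans; [apply Ha|].
    replace (Z.abs_nat (- Z.of_nat n - 1)) with (S n) by lia. simpl.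
    rewrite <- (Rmult_1_l (q ^ n)) at 2.
    apply Rmult_le_compat_l; [auto|].
    apply Rmult_le_compat_r; [apply pow_le|]; lra. }
  destruct H1 as [S1 (A1 & T1)], H2 as [S2 (A2 & T2)].
  split; [now apply has_sum_Z|]. exists (A1 + A2). now apply has_sum_Z.
Qed.

(** * The complex exponential and Gaussian terms *)

Lemma Cexp_plus (z w : C) : Cexp (z + w) = Cexp z * Cexp w.
Proof.
  unfold Cexp, Re, Im. destruct z as [a b], w as [c d]. simpl.
  rewrite exp_plus, cos_plus, sin_plus.
  apply injective_projections; simpl; ring.
Qed.

Lemma Cmod_Cexp (z : C) : Cmod (Cexp z) = exp (Re z).
Proof.
  unfold Cexp, Cmod. simpl fst; simpl snd.
  replace ((exp (Re z) * cos (Im z)) ^ 2 + (exp (Re z) * sin (Im z)) ^ 2)%R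
    with (exp (Re z) ^ 2)%R.
  - apply sqrt_pow2. left. apply exp_pos.
  - pose proof (sin2_cos2 (Im z)) as E. unfold Rsqr in E.
    transitivity (exp (Re z) ^ 2 * (sin (Im z) * sin (Im z) + cos (Im z) * cos (Im z)))%R;
      [rewrite E|]; ring.
Qed.

Lemma exp_pow (x : R) n : (exp x ^ n = exp (INR n * x))%R.
Proof.
  induction n as [|n IH]; [simpl; now rewrite Rmult_0_l, exp_0|].
  rewrite S_INR, Rmult_plus_distr_r, exp_plus, <- IH, Rmult_1_l. simpl. ring.
Qed.

Lemma abs_sum_gaussian (a : Z -> C) (al be ga : C) :
  (Re ga < 0)%R ->
  (forall j, a j = Cexp (al + be * RtoC (IZR j) + ga * RtoC (IZR j) ^ 2)) ->
  abs_sum a (CSeriesZ a).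
Proof.
  intros Hg Ha.
  (* The added 1 leaves a factor [exp (- |j|)] to spare, hence the ratio [exp (-1)]. *)
  set (t := (Rabs (Re be) + 1)%R).
  apply abs_sum_Z with (exp (Re al + t ^ 2 / (4 * - Re ga))) (exp (-1)).
  { split; [left; apply exp_pos|]. rewrite <- exp_0. apply exp_increasing. lra. }
  intros j. rewrite Ha, Cmod_Cexp, exp_pow, <- exp_plus.
  rewrite INR_IZR_INZ, Zabs2Nat.id_abs, abs_IZR.
  set (u := IZR j).
  assert (E : (Re (al + be * u + ga * u ^ 2) = Re al + Re be * u + Re ga * u ^ 2)%R).
  { unfold Re. simpl. ring. }
  rewrite E.
  assert (Hb : (Re be * u <= Rabs (Re be) * Rabs u)%R).
  { rewrite <- Rabs_mult. apply Rle_abs. }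
  rewrite <- (pow2_abs u). set (w := Rabs u) in *.
  assert (S : (t * w + Re ga * w ^ 2 <= t ^ 2 / (4 * - Re ga))%R).
  (* Completing the square bounds the linear and quadratic parts uniformly in [w]. *)
  { assert (X : (t ^ 2 / (4 * - Re ga) - t * w - Re ga * w ^ 2
             = (t + 2 * Re ga * w) ^ 2 / (4 * - Re ga))%R) by (field; lra).
    assert (Y : (0 <= (t + 2 * Re ga * w) ^ 2 / (4 * - Re ga))%R).
    { apply Rdiv_le_0_compat; [apply pow2_ge_0|lra]. }
    lra. }
  assert (Z : (Re al + Re be * u + Re ga * w ^ 2
    <= Re al + t ^ 2 / (4 * - Re ga) + w * -1)%R) by (unfold t in *; lra).
  destruct Z as [Z|Z]; [left; now apply exp_increasing|right; now f_equal].
Qed.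

(** * The three-term identity *)

Lemma Cexp_PI_even (n : Z) : Cexp (2 * PI * Ci * RtoC (IZR n)) = 1.
Proof.
  unfold Cexp, Re, Im. simpl.
  replace (((2 * PI - 0 * 0) * 0 - (2 * 0 + 0 * PI) * 1) * IZR n
    - ((2 * PI - 0 * 0) * 1 + (2 * 0 + 0 * PI) * 0) * 0)%R with 0%R by ring.
  replace (((2 * PI - 0 * 0) * 0 - (2 * 0 + 0 * PI) * 1) * 0
    + ((2 * PI - 0 * 0) * 1 + (2 * 0 + 0 * PI) * 0) * IZR n)%R with (0 + 2 * IZR n * PI)%R by ring.
  rewrite exp_0.
  (* Natural multiples of the period come first; negative [n] follows by parity of cos and sin. *)
  assert (P : forall k : nat, cos (0 + 2 * INR k * PI) = 1%R /\ sin (0 + 2 * INR k * PI) = 0%R).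
  { intros k. rewrite cos_period, sin_period, cos_0, sin_0. auto. }
  destruct (P (Z.abs_nat n)) as [P1 P2].
  rewrite INR_IZR_INZ, Zabs2Nat.id_abs in P1, P2.
  destruct (Z.abs_spec n) as [[_ E]|[_ E]]; rewrite E in P1, P2.
  - rewrite P1, P2. apply injective_projections; simpl; ring.
  - rewrite opp_IZR in P1, P2.
    replace (0 + 2 * - IZR n * PI)%R with (- (0 + 2 * IZR n * PI))%R in P1, P2 by ring.
    rewrite cos_neg in P1. rewrite sin_neg in P2.
    rewrite P1. replace (sin (0 + 2 * IZR n * PI)) with 0%R by lra.
    apply injective_projections; simpl; ring.
Qed.

Lemma Cexp_PI_odd (n : Z) : Cexp (2 * PI * Ci * RtoC (IZR n) + PI * Ci) = - (1).
Proof.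
  rewrite Cexp_plus, Cexp_PI_even.
  unfold Cexp, Re, Im. simpl.
  replace (PI * 0 - 0 * 1)%R with 0%R by ring.
  replace (PI * 1 + 0 * 0)%R with PI by ring.
  rewrite exp_0, cos_PI, sin_PI. apply injective_projections; simpl; ring.
Qed.

(* [even_term] and [odd_term] are the terms of the theta functions of modulus [2 tau] obtained
   from the even and odd values of [m] in [PI Ci (tau m^2 / 2 + 2 m x)]. *)
Definition even_term (tau x : C) (p : Z) : C :=
  Cexp (2 * PI * Ci * (tau * RtoC (IZR p) ^ 2 + 2 * RtoC (IZR p) * x)).

Definition odd_term (tau x : C) (p : Z) : C :=
  let h : C := RtoC (IZR p) + 1 / 2 in
  Cexp (2 * PI * Ci * (tau * h ^ 2 + 2 * h * x)).

(** * Oddness of the theta function *)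

Lemma CSeriesZ_reflect (a : Z -> C) : CSeriesZ (fun j => a (- j - 1)%Z) = CSeriesZ a.
Proof.
  unfold CSeriesZ, CSeries. rewrite Cplus_comm. f_equal.
  - f_equal; apply Series_ext; intros n; do 2 f_equal; lia.
Qed.

Lemma CSeriesZ_opp (a b : Z -> C) :
  (forall j, a j = - b j) -> CSeriesZ a = - CSeriesZ b.
Proof.
  intros E. unfold CSeriesZ, CSeries.
  assert (S1 : forall g : nat -> Z,
    Series (fun n => Re (a (g n))) = (- Series (fun n => Re (b (g n))))%R).
  { intros g. rewrite <- Series_opp. apply Series_ext. intros n. rewrite E. reflexivity. }
  assert (S2 : forall g : nat -> Z,
    Series (fun n => Im (a (g n))) = (- Series (fun n => Im (b (g n))))%R).
  { intros g. rewrite <- Series_opp. apply Series_ext. intros n. rewrite E. reflexivity. }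
  rewrite !S1, !S2. apply injective_projections; simpl; ring.
Qed.

(** Reflection turns [h = j + 1/2] into [-h]; because of the shift in [z + 1/2], the exponents then
    differ by an odd multiple of [PI Ci]. *)
Lemma theta1_neg (tau z : C) : theta1 tau (- z) = - theta1 tau z.
Proof.
  unfold theta1. f_equal. rewrite <- CSeriesZ_reflect. apply CSeriesZ_opp.
  intros j. unfold theta_term.
  rewrite minus_IZR, opp_IZR, RtoC_minus, RtoC_opp.
  replace (PI * Ci * tau * ((- RtoC (IZR j) - 1 + 1 / 2) * (- RtoC (IZR j) - 1 + 1 / 2)) +
    2 * PI * Ci * (- RtoC (IZR j) - 1 + 1 / 2) * (- z + 1 / 2))
   with (PI * Ci * tau * ((RtoC (IZR j) + 1 / 2) * (RtoC (IZR j) + 1 / 2)) +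
    2 * PI * Ci * (RtoC (IZR j) + 1 / 2) * (z + 1 / 2)
    + (2 * PI * Ci * RtoC (IZR (- j - 1)) + PI * Ci)).
  - rewrite Cexp_plus, Cexp_PI_odd. ring.
  - rewrite minus_IZR, opp_IZR, RtoC_minus, RtoC_opp. field.
Qed.

(* The Weierstrass identity for [f (p+q) f (p-q) f (r+s) f (r-s)] in the variables
   [a = p-q], [b = q-r], [c = r-s], [d = r+s], which avoid half-integer arguments. *)
Definition three_term (f : C -> C) : Prop := forall a b c d : C,
  f (a + 2 * b + c + d) * f a * f c * f d
  = f (a + b + c + d) * f (a + b) * f (b + c) * f (b + d)
    - f (a + b + c) * f (a + b + d) * f (b + c + d) * f b.

(** * Summability and the product formula *)

Section Summability.

Variable tau : C.
Hypothesis htau : (0 < Im tau)%R.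

Lemma Re_PI_Ci_tau (c : R) : (0 < c)%R -> (Re (c * PI * Ci * tau) < 0)%R.
Proof.
  intros Hc. pose proof (Rmult_lt_0_compat _ _ (Rmult_lt_0_compat _ _ Hc PI_RGT_0) htau).
  unfold Re, Im in *. simpl. lra.
Qed.

Lemma abs_sum_theta_term z :
  abs_sum (theta_term tau z) (CSeriesZ (theta_term tau z)).
Proof.
  apply abs_sum_gaussian with
    (PI * Ci * tau / 4 + PI * Ci * (z + 1 / 2))
    (PI * Ci * tau + 2 * PI * Ci * (z + 1 / 2)) (1 * PI * Ci * tau).
  - apply Re_PI_Ci_tau. lra.
  - intros j. unfold theta_term. f_equal. field.
Qed.

Lemma abs_sum_even_term z : abs_sum (even_term tau z) (CSeriesZ (even_term tau z)).
Proof.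
  apply abs_sum_gaussian with (RtoC 0) (4 * PI * Ci * z) (2 * PI * Ci * tau).
  - apply Re_PI_Ci_tau. lra.
  - intros j. unfold even_term. f_equal. ring.
Qed.

Lemma abs_sum_odd_term z : abs_sum (odd_term tau z) (CSeriesZ (odd_term tau z)).
Proof.
  apply abs_sum_gaussian with
    (PI * Ci * tau / 2 + 2 * PI * Ci * z)
    (2 * PI * Ci * tau + 4 * PI * Ci * z) (2 * PI * Ci * tau).
  - apply Re_PI_Ci_tau. lra.
  - intros j. unfold odd_term. f_equal. field.
Qed.

Definition theta_even z := CSeriesZ (even_term tau z).
Definition theta_odd z := CSeriesZ (odd_term tau z).

Lemma theta1_mul (x y : C) :
  theta1 tau (x + y) * theta1 tau (x - y)
  = theta_even x * theta_odd y - theta_odd x * theta_even y.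
Proof.
  (* With [m = j + k + 1] and [n = j - k], [inl] gives [m = 2p], [n = 2q + 1] and [inr] gives
     [m = 2p + 1], [n = 2q]. The shift by 1/2 contributes [exp (PI Ci m)], hence the minus sign on
     the [inr] part. *)
  pose (g := fun k : Z * Z + Z * Z =>
    match k with
    | inl (p, q) => (p + q, p - q - 1)%Z
    | inr (p, q) => (p + q, p - q)%Z
    end).
  pose proof (has_sum_prod _ _ _ _ (abs_sum_theta_term (x + y)) (abs_sum_theta_term (x - y))) as H1.
  apply (has_sum_bij g) in H1.
  - pose proof (has_sum_prod _ _ _ _ (abs_sum_even_term x) (abs_sum_odd_term y)) as H2.
    pose proof (has_sum_prod _ _ _ _ (abs_sum_odd_term x) (abs_sum_even_term y)) as H3.
    pose proof (has_sum_sum _ _ _ _ H2 (has_sum_opp _ _ H3)) as H4.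
    unfold theta1, theta_even, theta_odd.
    match goal with |- - ?u * - ?w = _ => replace (- u * - w) with (u * w) by ring end.
    apply (has_sum_unique _ _ _ H1).
    refine (has_sum_ext _ _ _ _ H4).
    intros [[p q]|[p q]]; simpl; unfold theta_term, even_term, odd_term; rewrite <- !Cexp_plus.
    (* A factor equal to 1 is inserted so that the exponents agree exactly, not only modulo
       [2 PI Ci]. *)
    + match goal with |- ?l = _ => transitivity (l * Cexp (2 * PI * Ci * RtoC (IZR p))) end;
        [rewrite Cexp_PI_even; ring|].
      rewrite <- Cexp_plus. f_equal.
      rewrite !minus_IZR, !plus_IZR, !RtoC_minus, !RtoC_plus. field.
    + match goal with |- - ?l = _ =>
        transitivity (l * Cexp (2 * PI * Ci * RtoC (IZR p) + PI * Ci)) end;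
        [rewrite Cexp_PI_odd; ring|].
      rewrite <- Cexp_plus. f_equal.
      rewrite !minus_IZR, !plus_IZR, !RtoC_minus, !RtoC_plus. field.
  (* In the mixed cases the parity of [j + k] gives a contradiction. *)
  - intros [[p q]|[p q]] [[p' q']|[p' q']] E; unfold g in E; injection E; intros;
      try lia; do 2 f_equal; lia.
  - intros [j k]. destruct (Z.Even_or_Odd (j + k)) as [[s E]|[s E]].
    + exists (inr (s, j - s)%Z). unfold g. f_equal; lia.
    + exists (inl (s + 1, j - s - 1)%Z). unfold g. f_equal; lia.
Qed.

Lemma theta1_three_term : three_term (theta1 tau).
Proof.
  intros a b c d.
  set (p := a + b + (c + d) / 2). set (q := b + (c + d) / 2).
  set (r := (c + d) / 2). set (s := (d - c) / 2).
  replace (a + 2 * b + c + d) with (p + q) by (unfold p, q; field).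
  (* Larger sums are rewritten before those they contain; [at 1] spares the [a] inside them. *)
  replace a with (p - q) at 1 by (unfold p, q; field).
  replace (a + b + c + d) with (p + r) by (unfold p, r; field).
  replace (a + b + c) with (p - s) by (unfold p, s; field).
  replace (a + b + d) with (p + s) by (unfold p, s; field).
  replace (a + b) with (p - r) by (unfold p, r; field).
  replace (b + c + d) with (q + r) by (unfold q, r; field).
  replace (b + c) with (q - s) by (unfold q, s; field).
  replace (b + d) with (q + s) by (unfold q, s; field).
  replace b with (q - r) by (unfold q, r; field).
  replace d with (r + s) by (unfold r, s; field).
  replace c with (r - s) by (unfold r, s; field).
  (* Grouped as [[pq][rs] = [pr][qs] - [ps][qr]], where [[xy]] is the minor that [theta1_mul]
     assigns to [f (x + y) f (x - y)]. *)
  transitivity ((theta1 tau (p + q) * theta1 tau (p - q))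
    * (theta1 tau (r + s) * theta1 tau (r - s))); [ring|].
  transitivity ((theta1 tau (p + r) * theta1 tau (p - r))
      * (theta1 tau (q + s) * theta1 tau (q - s))
    - (theta1 tau (p + s) * theta1 tau (p - s))
      * (theta1 tau (q + r) * theta1 tau (q - r))); [|ring].
  rewrite !theta1_mul. ring.
Qed.

End Summability.

(** * The weights *)

(* The tactics below name the value of [f] at each argument, up to sign. Arguments are
   integer combinations of [eta, lam, z, y, x, v] with small coefficients; replacing these
   by powers of 1000 gives an integer key, equal for equal arguments and negated
   for opposite ones. *)
Definition keyed (k : Z) (a b : C) : Prop := a = b.

Lemma keyed_exists (k : Z) (a : C) : exists b, keyed k a b.
Proof. exists a. reflexivity. Qed.

Lemma Cmult_neq_0_inv (a b : C) : a * b <> 0 -> a <> 0 /\ b <> 0.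
Proof. intros H. split; intros ->; apply H; ring. Qed.

Lemma Copp_neq_0_inv (a : C) : - a <> 0 -> a <> 0.
Proof. intros H ->. apply H. ring. Qed.

Ltac arg_key eta lam v x y z e :=
  let rec go e :=
    match e with
    | ?p + ?q => let a := go p in let b := go q in constr:((a + b)%Z)
    | ?p - ?q => let a := go p in let b := go q in constr:((a - b)%Z)
    | ?p * ?q => let a := go p in let b := go q in constr:((a * b)%Z)
    | - ?p => let a := go p in constr:((- a)%Z)
    | RtoC (IZR ?n) => n
    | eta => constr:(1%Z)
    | lam => constr:(1000%Z)
    | z => constr:(1000000%Z)
    | y => constr:(1000000000%Z)
    | x => constr:(1000000000000%Z)
    | v => constr:(1000000000000000%Z)
    end
  in let k := go e in eval vm_compute in k.

(** Keys only guide the search: each replacement is proved by [ring], so a collision of keys cannot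
    identify different values. *)
Ltac name_theta_values f odd eta lam v x y z :=
  repeat match goal with
  | |- context [f ?e] =>
      let k := arg_key eta lam v x y z e in
      lazymatch k with
      | Z.neg ?n =>
          lazymatch goal with
          | K : keyed (Z.pos n) (f ?e0) ?u |- _ =>
              replace (f e) with (- u)
                by (rewrite <- K, <- odd; f_equal; ring)
          | _ =>
              let u := fresh "u" in let K := fresh "K" in
              destruct (keyed_exists (Z.pos n) (f (- e))) as (u & K);
              replace (f e) with (- u)
                by (rewrite <- K, <- odd; f_equal; ring)
          end
      | _ =>
          lazymatch goal with
          | K : keyed k (f ?e0) ?u |- _ =>
              replace (f e) with u by (rewrite <- K; f_equal; ring)
          | _ =>
              let u := fresh "u" in let K := fresh "K" in
              destruct (keyed_exists k (f e)) as (u & K);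
              replace (f e) with u by (rewrite <- K; reflexivity)
          end
      end
  end.

Ltac add_nonzero H :=
  lazymatch type of H with
  | RtoC 1 <> RtoC 0 => idtac
  | ?p * ?q <> RtoC 0 =>
      add_nonzero (proj1 (Cmult_neq_0_inv p q H));
      add_nonzero (proj2 (Cmult_neq_0_inv p q H))
  | ?P => lazymatch goal with
          | _ : P |- _ => idtac
          | _ => let N := fresh "N" in assert (N : P) by exact H
          end
  end.

Ltac split_nonzero :=
  repeat match goal with
  | H : _ * _ <> RtoC 0 |- _ => add_nonzero H; clear H
  | H : RtoC 1 <> RtoC 0 |- _ => clear H
  end.

Ltac ybe_hyps H :=
  let inst b1 b2 b3 :=
    (let T := fresh in pose proof (H b1 b2 b3) as T;
     cbv [weight_ok weight_den bit] in T; decompose [and] T; clear T) in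
  inst false false false; inst false false true; inst false true false;
  inst false true true; inst true false false; inst true false true;
  inst true true false; inst true true true; clear H;
  split_nonzero.

Ltac simpl_weights :=
  cbv [sum01 weight bit];
  repeat first [rewrite Cmult_0_l | rewrite Cmult_0_r | rewrite Cplus_0_l
    | rewrite Cplus_0_r | rewrite Cmult_1_l | rewrite Cmult_1_r].

Ltac theta_atoms odd tau eta lam v x y z :=
  let f := fresh "f" in
  set (f := theta1 tau) in *;
  (* The nonvanishing hypotheses join the goal so that their theta values receive the same names. *)
  repeat match goal with H : f _ <> _ |- _ => revert H end;
  name_theta_values f odd eta lam v x y z; intros;
  repeat match goal with H : - _ <> RtoC 0 |- _ => apply Copp_neq_0_inv in H end.

(** * The dynamical Yang-Baxter equation by components *)

Definition ybe (tau eta : C) (i1 j1 k1 i3 j3 k3 : bool) : Prop :=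
  forall lam v x y z : C,
    (forall i2 j2 k2 : bool,
      weight_ok tau eta i1 j1 i2 j2 lam (v - 2 * eta * bit k1) x y /\
      weight_ok tau eta k1 j2 k2 j3 (lam + 2 * eta * (2 * bit i2 - 1)) v x z /\
      weight_ok tau eta k2 i2 k3 i3 lam (v - 2 * eta * bit j3) y z /\
      weight_ok tau eta k1 i1 k2 i2 (lam + 2 * eta * (2 * bit j1 - 1)) v y z /\
      weight_ok tau eta k2 j1 k3 j2 lam (v - 2 * eta * bit i2) x z /\
      weight_ok tau eta i2 j2 i3 j3 (lam + 2 * eta * (2 * bit k3 - 1)) v x y) ->
    sum01 (fun i2 => sum01 (fun j2 => sum01 (fun k2 =>
      weight tau eta i1 j1 i2 j2 lam (v - 2 * eta * bit k1) x y
      * weight tau eta k1 j2 k2 j3 (lam + 2 * eta * (2 * bit i2 - 1)) v x z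
      * weight tau eta k2 i2 k3 i3 lam (v - 2 * eta * bit j3) y z)))
    =
    sum01 (fun i2 => sum01 (fun j2 => sum01 (fun k2 =>
      weight tau eta k1 i1 k2 i2 (lam + 2 * eta * (2 * bit j1 - 1)) v y z
      * weight tau eta k2 j1 k3 j2 lam (v - 2 * eta * bit i2) x z
      * weight tau eta i2 j2 i3 j3 (lam + 2 * eta * (2 * bit k3 - 1)) v x y))).

Section Algebra.

Variables (tau eta : C).
Hypothesis theta1_neg : forall z, theta1 tau (- z) = - theta1 tau z.
Hypothesis theta1_three_term : three_term (theta1 tau).

(** A nonzero weight has [i1 + j1 = i2 + j2], so every nonzero term conserves the total of the three
    outer indices; here both sides vanish. *)
Lemma ybe_not_conserved (i1 j1 k1 i3 j3 k3 : bool) :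
  (Nat.b2n i1 + Nat.b2n j1 + Nat.b2n k1 <> Nat.b2n i3 + Nat.b2n j3 + Nat.b2n k3)%nat ->
  ybe tau eta i1 j1 k1 i3 j3 k3.
Proof.
  intros Hc lam v x y z _.
  destruct i1, j1, k1, i3, j3, k3; simpl in Hc; try (exfalso; apply Hc; reflexivity);
    clear Hc; simpl_weights; reflexivity.
Qed.

Ltac by_cancellation :=
  intros lam v x y z H; ybe_hyps H; simpl_weights;
  theta_atoms theta1_neg tau eta lam v x y z;
  try field; repeat split; assumption.

(** [R] selects the instance, which is posed before naming so as to share the names. [field [HW]]
    uses it to rewrite the monomial on its left side. *)
Ltac by_three_term R :=
  intros lam v x y z H;
  let HW := fresh "HW" in
  pose proof (R lam x y z) as HW; revert HW;
  ybe_hyps H; simpl_weights; theta_atoms theta1_neg tau eta lam v x y z;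
  match goal with HW : _ * _ * _ * _ = _ |- _ => field [HW] end;
  repeat split; assumption.

Ltac by_two_three_terms R1 R2 :=
  intros lam v x y z H;
  let HW1 := fresh "HW" in let HW2 := fresh "HW" in
  pose proof (R1 lam x y z) as HW1; pose proof (R2 lam x y z) as HW2;
  revert HW1 HW2;
  ybe_hyps H; simpl_weights; theta_atoms theta1_neg tau eta lam v x y z;
  match goal with
  | HW1 : _ * _ * _ * _ = _, HW2 : _ * _ * _ * _ = _ |- _ => field [HW1 HW2]
  end;
  repeat split; assumption.

Lemma ybe_all (i1 j1 k1 i3 j3 k3 : bool) : ybe tau eta i1 j1 k1 i3 j3 k3.
Proof.
  pose proof theta1_three_term as W.
  (* Conservation leaves 20 of the 64 components. *)
  destruct i1, j1, k1, i3, j3, k3;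
    try (apply ybe_not_conserved; discriminate).
  (* Cases are labelled [i1 j1 k1 -> i3 j3 k3]. *)
  - (* 111 -> 111 *)
    by_cancellation.
  - (* 110 -> 110 *)
    by_cancellation.
  - (* 110 -> 101 *)
    (* With [h = 2 eta], clearing denominators turns the only left-hand term into the product with
       [f (lam + x - z + h)]. The right-hand term with [k2 = 0] gives the left side of the instance,
       the one with [k2 = 1] its subtracted product. *)
    by_three_term (fun lam x y z : C => W (y - z) (- (2 * eta)) (lam + 4 * eta) (x - y)).
  - (* 110 -> 011 *)
    by_three_term (fun lam x y z : C => W (- x + y) (2 * eta) (x - z - 2 * eta) lam).
  - (* 101 -> 110 *)
    by_three_term (fun lam x y z : C => W (x - y) (- lam) (lam - 2 * eta) (y - z)).
  - (* 101 -> 101 *)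
    by_cancellation.
  - (* 101 -> 011 *)
    by_three_term (fun lam x y z : C => W (- x + z) (2 * eta) lam (y - z - 2 * eta)).
  - (* 100 -> 100 *)
    (* With [h = 2 eta], the terms without [f h ^ 3] combine, up to sign, to
       [f (x-y) f (y-z) f (x-z-h) (f lam ^ 3 f (lam-2h) - f (lam-h) ^ 3 f (lam+h))],
       where the bracket is [- f h ^ 3 f (2lam-h)] by the first instance. *)
    by_two_three_terms (fun lam x y z : C => W lam (- (2 * eta)) lam (- lam))
      (fun lam x y z : C => W (x - y) (- lam) (y - z) (2 * lam - 2 * eta)).
  - (* 100 -> 010 *)
    by_three_term (fun lam x y z : C => W (2 * eta) (- lam) (lam - x + z) (x - y)).
  - (* 100 -> 001 *)
    by_three_term (fun lam x y z : C => W (x - z) (- (2 * eta)) lam (- x + y + 2 * eta)).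
  - (* 011 -> 110 *)
    by_three_term (fun lam x y z : C => W (- x + z) (2 * eta) (x - y - 2 * eta) lam).
  - (* 011 -> 101 *)
    by_three_term (fun lam x y z : C => W (- y + z) (2 * eta) lam (x - z - 2 * eta)).
  - (* 011 -> 011 *)
    (* With [h = 2 eta], the bracket is now [f lam ^ 3 f (lam+2h) - f (lam+h) ^ 3 f (lam-h)], equal
       to [f h ^ 3 f (2lam+h)] by the first instance; the second has
       [f (2lam+h) f (x-y) f (y-z) f (z-x+h)] on its left. *)
    by_two_three_terms (fun lam x y z : C => W lam (2 * eta) lam (- lam))
      (fun lam x y z : C => W (x - y) lam (y - z) (- x + z + 2 * eta)).
  - (* 010 -> 100 *)
    by_three_term (fun lam x y z : C => W (x - z) (- (2 * eta)) lam (- y + z + 2 * eta)).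
  - (* 010 -> 010 *)
    by_cancellation.
  - (* 010 -> 001 *)
    by_three_term (fun lam x y z : C => W (x - y) (- (2 * eta)) (lam + 2 * eta) (y - z)).
  - (* 001 -> 100 *)
    by_three_term (fun lam x y z : C => W (y - z) (- lam) (lam - x + z) (2 * eta)).
  - (* 001 -> 010 *)
    by_three_term (fun lam x y z : C => W (y - z) (- (2 * eta)) (lam - x + z) (x - y)).
  - (* 001 -> 001 *)
    by_cancellation.
  - (* 000 -> 000 *)
    by_cancellation.
Qed.

Lemma weight_sum (x y lam v : C) (i1 j1 : bool) :
  (forall i2 j2 : bool, weight_ok tau eta i1 j1 i2 j2 lam v x y) ->
  sum01 (fun i2 => sum01 (fun j2 => weight tau eta i1 j1 i2 j2 lam v x y)) = 1.
Proof.
  (* Both nonzero weights of a mixed incoming pair share one denominator, so one outgoing pair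
     suffices. *)
  intros H. specialize (H true false).
  (* The products in [W10] are, up to sign, the two numerators and the common denominator for
     incoming [1, 0]; [W01] does the same for [0, 1], with the denominator on the left. *)
  pose proof (theta1_three_term (x - y) (- lam) (lam - 2 * eta) (v - x)) as W10.
  pose proof (theta1_three_term (x - y - 2 * eta) (2 * eta) lam (y - v)) as W01.
  revert W10 W01.
  destruct i1, j1; cbv [weight_ok weight_den] in H; split_nonzero; simpl_weights.
  1, 4: intros; ring.
  (* No [z] occurs here; [v] fills its slot. *)
  all: theta_atoms theta1_neg tau eta lam v x y v.
  - field [W10]; repeat split; assumption.
  - field [W01]; repeat split; assumption.
Qed.

End Algebra.

Theorem theorem1p2 (tau eta : C) (htau : (0 < Im tau)%R) :
  (forall (x y lam v : C) (i1 j1 : bool),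
    (forall i2 j2 : bool, weight_ok tau eta i1 j1 i2 j2 lam v x y) ->
    sum01 (fun i2 => sum01 (fun j2 => weight tau eta i1 j1 i2 j2 lam v x y)) = 1)
  /\
  (forall (i1 j1 k1 i3 j3 k3 : bool) (lam v x y z : C),
    (forall i2 j2 k2 : bool,
      weight_ok tau eta i1 j1 i2 j2 lam (v - 2 * eta * bit k1) x y /\
      weight_ok tau eta k1 j2 k2 j3 (lam + 2 * eta * (2 * bit i2 - 1)) v x z /\
      weight_ok tau eta k2 i2 k3 i3 lam (v - 2 * eta * bit j3) y z /\
      weight_ok tau eta k1 i1 k2 i2 (lam + 2 * eta * (2 * bit j1 - 1)) v y z /\
      weight_ok tau eta k2 j1 k3 j2 lam (v - 2 * eta * bit i2) x z /\
      weight_ok tau eta i2 j2 i3 j3 (lam + 2 * eta * (2 * bit k3 - 1)) v x y) ->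
    sum01 (fun i2 => sum01 (fun j2 => sum01 (fun k2 =>
      weight tau eta i1 j1 i2 j2 lam (v - 2 * eta * bit k1) x y
      * weight tau eta k1 j2 k2 j3 (lam + 2 * eta * (2 * bit i2 - 1)) v x z
      * weight tau eta k2 i2 k3 i3 lam (v - 2 * eta * bit j3) y z)))
    =
    sum01 (fun i2 => sum01 (fun j2 => sum01 (fun k2 =>
      weight tau eta k1 i1 k2 i2 (lam + 2 * eta * (2 * bit j1 - 1)) v y z
      * weight tau eta k2 j1 k3 j2 lam (v - 2 * eta * bit i2) x z
      * weight tau eta i2 j2 i3 j3 (lam + 2 * eta * (2 * bit k3 - 1)) v x y)))).
Proof.
  pose proof (theta1_neg tau) as Hneg.
  pose proof (theta1_three_term tau htau) as W.
  split.
  - now apply weight_sum.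
  - intros i1 j1 k1 i3 j3 k3. now apply ybe_all.
Qed.
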